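(* For every $M\ge1$ and every $\mathbf p=(p_1,\dots,p_M)\in(0,1)^M$, $$\lim_{\kappa\to\infty}\chi(\mathbf p;\kappa)=\mathrm{Sto}(\mathbf p)=1-\Phi\Big(\frac{1}{\sqrt M}\sum_{i=1}^M\Phi^{-1}(1-p_i)\Big).$$
   Context: $F_\chi(x;\kappa)$ denotes the CDF of the $\chi^2$ distribution with $\kappa>0$ degrees of freedom, $F_\chi(x;\kappa)=\int_0^x\frac{t^{\kappa/2-1}e^{-t/2}}{2^{\kappa/2}\Gamma(\kappa/2)}dt$, and $F_\chi^{-1}(\cdot;\kappa)$ its quantile function. The chi-squared quantile pooled $p$-value is $\chi(\mathbf p;\kappa)=1-F_\chi\big(\sum_{i=1}^M F_\chi^{-1}(1-p_i;\kappa);\,M\kappa\big)$. $\Phi$ is the standard normal CDF. *)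

(* Defs.v *)
From HB Require Import structures.
From mathcomp Require Import all_boot all_order all_algebra.
From mathcomp Require Import all_classical all_reals all_analysis.
Set Implicit Arguments. Unset Strict Implicit. Unset Printing Implicit Defensive.
Import Order.TTheory GRing.Theory Num.Theory.
Import numFieldNormedType.Exports.
Local Open Scope classical_set_scope.
Local Open Scope ring_scope.

Section defs.
Context {R : realType}.
Notation mu := (@lebesgue_measure R).

Definition Gamma (s : R) : R :=
  fine (\int[mu]_(t in [set t : R | (0 < t)%R]) (t `^ (s - 1) * expR (- t))%:E)%E.

Definition chi2_pdf (kappa t : R) : R :=
  t `^ (kappa / 2 - 1) * expR (- t / 2) / (2 `^ (kappa / 2) * Gamma (kappa / 2)).

Definition chi2_cdf (kappa x : R) : R :=
  fine (\int[mu]_(t in `]0%R, x]) (chi2_pdf kappa t)%:E)%E.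

Definition Phi (x : R) : R := fine (normal_prob 0 1 `]-oo, x]).

Definition quantile (F : R -> R) (u : R) : R := inf [set x | u <= F x].

Definition chi_pool (M : nat) (p : 'I_M -> R) (kappa : R) : R :=
  1 - chi2_cdf (M%:R * kappa)
        (\sum_(i < M) quantile (chi2_cdf kappa) (1 - p i)).

Definition Sto (M : nat) (p : 'I_M -> R) : R :=
  1 - Phi ((Num.sqrt (M%:R))^-1 * \sum_(i < M) quantile Phi (1 - p i)).
End defs.

(* Main.v *)
(** Put kappa = 2 n^2. The density of (X - kappa) / (2 n), for X chi-squared with kappa degrees of freedom, is proportional to (1 + w/n)^(n^2-1) exp(-n w) on w > -n, which tends to exp(-w^2/2) and is dominated, uniformly in n >= 2, by a multiple of exp(-|w|/4). By dominated convergence its integrals over ]-oo, y_n] with y_n -> y, and over the whole line, both converge. The normalising factor coming from Gamma(n^2) cancels in their quotient, so neither Stirling's formula nor the central limit theorem is needed, and the standardised chi-squared CDF at y_n tends to Phi(y).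
Since Phi is strictly increasing, the standardised quantiles (Q(u) - kappa) / (2 n) tend to Phi^-1(u). A sum of M quantiles, standardised for M kappa degrees of freedom, is the sum of the standardised quantiles divided by sqrt M; apply the CDF limit once more at this moving argument. *)
Require Import Defs.
From HB Require Import structures.
From mathcomp Require Import all_boot all_order all_algebra.
From mathcomp Require Import ring lra.
From mathcomp Require Import all_classical all_reals all_analysis measurable_realfun.
Import Order.TTheory GRing.Theory Num.Theory.
Import numFieldNormedType.Exports.
Local Open Scope classical_set_scope.
Local Open Scope ring_scope.
Set Implicit Arguments. Unset Strict Implicit. Unset Printing Implicit Defensive.

(** * Affine change of variables for Lebesgue integrals *)

Lemma affine_measurable (R : realType) (a c : R) :
  measurable_fun setT (fun w : R => a + c * w).
Proof. by apply: measurable_funD => //; exact: measurable_funM. Qed.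

Lemma preimage_affine_itvoc (R : realType) (a c x y : R) : 0 < c ->
  (fun w => a + c * w) @^-1` `]x, y] = `](x - a) / c, (y - a) / c]%classic.
Proof.
move=> c0; apply/seteqP; split => w /=; rewrite !in_itv/= ltr_pdivrMr// ler_pdivlMr//;
  move=> /andP[h1 h2]; apply/andP; split; lra.
Qed.

(** Lebesgue measure is [c] times its own pushforward along the inverse scaling: the two measures
    agree on half-open intervals, so uniqueness identifies them. *)
Lemma ge0_integral_affine (R : realType) (a c : R) (D : set R) (f : R -> R) :
  0 < c -> measurable D -> measurable_fun setT f -> (forall x, 0 <= f x) ->
  (\int[lebesgue_measure]_(x in D) (f x)%:E =
   c%:E * \int[lebesgue_measure]_(w in (fun w => (a + c * w)%R) @^-1` D)
     (f (a + c * w))%:E)%E.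
Proof.
move=> c0 mD mf f0.
have mphi := @affine_measurable R a c.
pose phi := fun w : measurableTypeR R => (a + c * w) : measurableTypeR R.
pose m : {measure set (measurableTypeR R) -> \bar R} :=
  mscale (NngNum (ltW c0)) lebesgue_measure.
have mE A : measurable A -> lebesgue_measure A = pushforward m phi A.
  move=> mA; unshelve apply: lebesgue_measure_unique => //.
  move=> _ [[x y] _ <-].
  rewrite /m /= /mscale /pushforward /= preimage_affine_itvoc//.
  rewrite !lebesgue_measure_itv /= !lte_fin ltr_pM2r ?invr_gt0// ltrD2r.
  case: ifP => xy; last by rewrite mule0.
  by rewrite -!EFinD -EFinM; congr EFin; field; lra.
have mfD : measurable_fun D (fun x => (f x)%:E).
  by apply/measurable_EFinP; exact: measurable_funTS.
have mD' : measurable (phi @^-1` D) by rewrite -[X in measurable X]setTI; exact: mphi.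
transitivity (\int[pushforward m phi]_(x in D) (f x)%:E)%E.
  by unshelve apply: eq_measure_integral => // A mA _; exact: mE.
rewrite (@ge0_integral_pushforward _ _ (measurableTypeR R) (measurableTypeR R) R
  phi mphi)//; last by move=> x _; rewrite lee_fin.
rewrite ge0_integral_mscale//=; last by move=> x _; rewrite lee_fin.
apply/measurable_EFinP/measurable_funTS.
exact: (measurableT_comp mf mphi).
Qed.

(** * Two estimates of ln (1 + x) *)

(** Serves the pointwise limit. The expression in the norm has derivative x^2 / (1 + x), at most 2
    x^2 on this range; the mean value theorem from 0 supplies the third factor |x|. *)
Lemma ln1D_taylor2 (R : realType) (x : R) : `|x| <= 2^-1 ->
  `|ln (1 + x) - x + x ^+ 2 / 2| <= 2 * `|x| ^+ 3.
Proof.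
move=> x2.
pose f y : R := ln (1 + y) - y + y ^+ 2 / 2.
pose df y : R := y ^+ 2 / (1 + y).
have dfE (y : R) : -1 < y -> is_derive y 1 f (df y).
  move=> y1.
  have y10 : 0 < 1 + y by lra.
  have := is_derive1_ln y10 => H.
  rewrite /f; apply: is_derive_eq.
  rewrite /df /GRing.scale/=; field; lra.
have cf (y : R) : -1 < y -> {for y, continuous f}.
  by move=> y1; apply/differentiable_continuous/derivable1_diffP; have [] := dfE _ y1.
have key (a b : R) : a <= b -> -2^-1 <= a -> b <= 2^-1 ->
    exists2 c : R, c \in `[a, b] & f b - f a = df c * (b - a).
  move=> ab a2 b2; apply: MVT_segment => //.
    by move=> y; rewrite in_itv/= => /andP[ay yb]; apply: dfE; lra.
  apply: continuous_in_subspaceT => y; rewrite inE/= in_itv/= => /andP[ay yb].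
  by apply: cf; lra.
have dfb (c : R) : -2^-1 <= c -> `|c| <= `|x| -> `|df c| <= 2 * `|x| ^+ 2.
  move=> c2 cx; rewrite /df normrM normfV normrX (ger0_norm (x := 1 + c)); last lra.
  rewrite ler_pdivrMr; last lra.
  have : `|c| ^+ 2 <= `|x| ^+ 2 by rewrite lerXn2r ?nnegrE.
  have := sqr_ge0 `|x|; nra.
have f0 : f 0 = 0 by rewrite /f addr0 ln1 expr0n/=; lra.
move: (x2); rewrite ler_norml => /andP[xl xr].
have -> : ln (1 + x) - x + x ^+ 2 / 2 = f x by [].
have [x0|x0] := leP 0 x.
  have [||| c +] := key 0 x; [by []|lra|by []|].
  rewrite in_itv/= f0 !subr0 => /andP[c0 cx] ->.
  rewrite normrM exprSr mulrA ler_wpM2r// dfb//; first lra.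
  by rewrite !ger0_norm.
have [||| c +] := key x 0; [lra|lra|lra|].
rewrite in_itv/= f0 !sub0r => /andP[c0 cx] /eqP; rewrite eqr_oppLR => /eqP ->.
rewrite normrN normrM normrN exprSr mulrA ler_wpM2r// dfb//; first lra.
by rewrite !ler0_norm; lra.
Qed.

(** Serves the domination: a bound on the whole domain, quadratic near 0 and linear at infinity. *)
Lemma ln1D_le (R : realType) (x : R) : -1 < x ->
  ln (1 + x) - x <= - (x ^+ 2 / (2 * (1 + `|x|))).
Proof.
move=> x1.
have key (f df : R -> R) (a b : R) : (forall y : R, -1 < y -> is_derive y 1 f (df y)) ->
    -1 < a -> a <= b ->
    exists2 c : R, c \in `[a, b] & f b - f a = df c * (b - a).
  move=> dfE a1 ab; apply: MVT_segment => //.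
    by move=> y; rewrite in_itv/= => /andP[ay yb]; apply: dfE; lra.
  apply: continuous_in_subspaceT => y; rewrite inE/= in_itv/= => /andP[ay yb].
  apply/differentiable_continuous/derivable1_diffP.
  by have [] := dfE y ltac:(lra).
have [x0|x0] := leP 0 x.
  (* Chosen so that [f x <= 0] is exactly the claim; its derivative is minus half a square. *)
  pose f y : R := ln (1 + y) - ((1 + y) - (1 + y)^-1) / 2.
  pose df y : R := - (1 - (1 + y)^-1) ^+ 2 / 2.
  have dfE (y : R) : -1 < y -> is_derive y 1 f (df y).
    move=> y1.
    have y10 : 0 < 1 + y by lra.
    have := is_derive1_ln y10 => H.
    have y1n : 1 + y != 0 by rewrite gt_eqF.
    rewrite /f; apply: is_derive_eq.
    by rewrite /df /GRing.scale/=; field.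
  have [|| c _] := key f df 0 x dfE; [lra|by []|].
  have -> : f 0 = 0 by rewrite /f !addr0 ln1 invr1; lra.
  rewrite !subr0 => fx.
  have : f x <= 0 by rewrite fx /df; have := sqr_ge0 (1 - (1 + c)^-1); nra.
  rewrite /f ger0_norm//.
  have -> : - (x ^+ 2 / (2 * (1 + x))) = ((1 + x) - (1 + x)^-1) / 2 - x.
    field; lra.
  lra.
(* For negative x the remainder of the quadratic Taylor polynomial increases to 0 at 0, so ln (1 +
   x) - x <= - x^2 / 2; dividing by 1 + |x| >= 1 only weakens this. *)
pose f y : R := ln (1 + y) - y + y ^+ 2 / 2.
pose df y : R := y ^+ 2 / (1 + y).
have dfE (y : R) : -1 < y -> is_derive y 1 f (df y).
  move=> y1.
  have y10 : 0 < 1 + y by lra.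
  have := is_derive1_ln y10 => H.
  rewrite /f; apply: is_derive_eq.
  rewrite /df /GRing.scale/=; field; lra.
have [|| c +] := key f df x 0 dfE; [lra|lra|].
rewrite in_itv/= => /andP[xc c0].
have -> : f 0 = 0 by rewrite /f addr0 ln1 expr0n/=; lra.
rewrite !sub0r => fx.
have dfc : 0 <= df c by rewrite /df divr_ge0 ?sqr_ge0//; lra.
have : f x <= 0 by nra.
rewrite /f => fx0.
have : x ^+ 2 / (2 * (1 + `|x|)) <= x ^+ 2 / 2.
  rewrite ler_wpM2l ?sqr_ge0// lef_pV2 ?posrE; have := normr_ge0 x; lra.
lra.
Qed.

(** * The rescaled chi-squared density and its Gaussian limit *)

(* Up to a factor depending only on n, the density at w of (X - 2 n^2) / (2 n) for X chi-squared with 2 n^2 degrees of freedom. *)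
Definition chi2_kernel (R : realType) (n w : R) : R :=
  \1_(`]- n, +oo[) w * expR ((n ^+ 2 - 1) * ln (1 + w / n) - n * w).

Lemma chi2_kernel_ge0 (R : realType) (n w : R) : 0 <= chi2_kernel n w.
Proof. by rewrite mulr_ge0// expR_ge0. Qed.

Lemma measurable_chi2_kernel (R : realType) (n : R) :
  measurable_fun setT (chi2_kernel n).
Proof.
apply: measurable_funM; first exact: measurable_indic.
apply: measurableT_comp => //.
apply: measurable_funB; last exact: measurable_funM.
apply: measurable_funM => //.
apply: (@measurableT_comp _ _ _ _ _ _ (@ln R)); first exact: measurable_ln.
by apply: measurable_funD => //; exact: measurable_funM.
Qed.

(** With x = w / n the exponent is (n^2 - 1) (ln (1 + x) - x) - x: [ln1D_le] controls the first
    term, and x > -1 bounds the second by 1. *)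
Lemma chi2_kernel_le (R : realType) (n w : R) : 2 <= n ->
  chi2_kernel n w <= expR (5 / 4) * expR (- (4^-1 * `|w|)).
Proof.
move=> n2; rewrite /chi2_kernel indicE.
have n0 : 0 < n by lra.
have [|_] := boolP (w \in _); last by rewrite mul0r mulr_ge0 ?expR_ge0.
rewrite inE/= in_itv/= andbT mul1r => nw.
rewrite -expRD ler_expR.
set x := w / n.
have wE : w = n * x by rewrite /x; field; rewrite gt_eqF.
have x1 : -1 < x by rewrite /x ltr_pdivlMr//; lra.
have := ln1D_le x1.
have Nw : `|w| = n * `|x| by rewrite wE normrM gtr0_norm.
have xn0 : 0 <= `|x| by [].
have xx : -x <= `|x| by rewrite -normrN ler_norm.
have x2 : x ^+ 2 = `|x| ^+ 2 by rewrite real_normK// num_real.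
rewrite Nw wE; set L := ln _; rewrite x2; set y := `|x| in xn0 xx *.
move=> HL.
have H1 : (n ^+ 2 - 1) * (L - x) <= - ((n ^+ 2 - 1) * (y ^+ 2 / (2 * (1 + y)))).
  have n21 : 0 <= n ^+ 2 - 1 by nra.
  by have := ler_wpM2l n21 HL; rewrite mulrN.
have x_le1 : - x <= 1 by lra.
(* From n^2 - 1 >= n^2 / 2 and y <= n y; what remains depends on n y = |w| alone. *)
have H2 : (n ^+ 2 / 2) * (y ^+ 2 / (2 * (1 + n * y))) <= (n ^+ 2 - 1) * (y ^+ 2 / (2 * (1 + y))).
  apply: ler_pM => //.
  - by rewrite divr_ge0 ?sqr_ge0.
  - by rewrite divr_ge0 ?sqr_ge0//; nra.
  - by nra.
  - by rewrite ler_wpM2l ?sqr_ge0// lef_pV2 ?posrE; nra.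
(* With t = |w| this is (t - 1) (t + 1) <= t^2. Its 1/4, added to the 1 of [x_le1], makes the
   constant 5/4. *)
have H3 : (n * y - 1) / 4 <= (n ^+ 2 / 2) * (y ^+ 2 / (2 * (1 + n * y))).
  have -> : (n ^+ 2 / 2) * (y ^+ 2 / (2 * (1 + n * y))) = (n * y) ^+ 2 / (4 * (1 + n * y)).
    by field; nra.
  by rewrite ler_pdivlMr; nra.
have -> : (n ^+ 2 - 1) * L - n * (n * x) = (n ^+ 2 - 1) * (L - x) - x by ring.
lra.
Qed.

(** Symmetry reduces this to the half-line, where the integrand is 1/r times the exponential
    density. *)
Lemma integrable_expRN_norm (R : realType) (r : R) : 0 < r ->
  (@lebesgue_measure R).-integrable setT (fun w => (expR (- (r * `|w|)))%:E).
Proof.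
move=> r0.
have cf : continuous (fun w : R => expR (- (r * `|w|))).
  move=> w; apply: continuous_comp; last exact: continuous_expR.
  apply: continuousN; apply: continuousM; first exact: cst_continuous.
  exact: norm_continuous.
have mf : measurable_fun setT (fun w : R => expR (- (r * `|w|))).
  exact: continuous_measurable_fun.
apply/integrableP; split; first exact/measurable_EFinP.
under eq_integral do rewrite /= ger0_norm ?expR_ge0//.
rewrite ge0_symfun_integralT//; last by move=> w /=; rewrite normrN.
apply: lte_mul_pinfty => //.
have -> : (\int[lebesgue_measure]_(x in [set x | (0 <= x)%R]) (expR (- (r * `|x|)))%:E =
  (r^-1)%:E * \int[lebesgue_measure]_(x in [set x | (0 <= x)%R]) (exponential_pdf r x)%:E)%E.
  rewrite -ge0_integralZl_EFin//=; last 4 first.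
  - by rewrite -set_itvcy.
  - by move=> x _; rewrite lee_fin exponential_pdf_ge0// ltW.
  - apply/measurable_EFinP/measurable_funTS; exact: measurable_exponential_pdf.
  - by rewrite invr_ge0 ltW.
  apply: eq_integral => x; rewrite inE/= => x0; rewrite -EFinM; congr EFin.
  by rewrite exponential_pdfE// mulrA mulVf ?gt_eqF// mul1r ger0_norm// mulNr.
apply: lte_mul_pinfty => //; first by rewrite lee_fin invr_ge0 ltW.
apply: (@le_lt_trans _ _ (\int[lebesgue_measure]_x (exponential_pdf r x)%:E)%E).
  apply: ge0_subset_integral => //.
  - by rewrite -set_itvcy.
  - apply/measurable_EFinP; exact: measurable_exponential_pdf.
  - by move=> x _; rewrite lee_fin exponential_pdf_ge0// ltW.
by rewrite integral_exponential_pdf// ltry.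
Qed.

(** Second-order expansion of the logarithm at x = w / n: the terms n w cancel, n^2 x^2 / 2 is w^2 /
    2, and the rest is O(1/n). *)
Lemma cvg_chi2_kernel (R : realType) (n : R^nat) (w : R) :
  (forall k, 2 <= n k) -> n @ \oo --> +oo ->
  chi2_kernel (n k) w @[k --> \oo] --> normal_fun 0 1 w.
Proof.
move=> n2 ny.
have n0 k : 0 < n k by have := n2 k; lra.
have v0 : (n k)^-1 @[k --> \oo] --> (0 : R).
  by apply/gtr0_cvgV0 => //; exact: nearW.
have E : (n k ^+ 2 - 1) * ln (1 + w / n k) - n k * w @[k --> \oo] --> - (w ^+ 2 / 2).
  apply/cvgrPdist_le => e e0.
  (* The three summands bound, in order, the cubic remainder ([h1]), x^2 / 2 ([h3]) and x ([h2]). *)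
  have vB : (n k)^-1 * (2 * `|w| ^+ 3 + w ^+ 2 + `|w|) @[k --> \oo] --> (0 : R).
    rewrite -[X in _ --> X](mul0r (2 * `|w| ^+ 3 + w ^+ 2 + `|w|)).
    by apply: cvgM => //; exact: cvg_cst.
  move/cvgr0Pnorm_le : vB => /(_ _ e0) vB.
  have vw : (n k)^-1 * w @[k --> \oo] --> (0 : R).
    rewrite -[X in _ --> X](mul0r w).
    by apply: cvgM => //; exact: cvg_cst.
  have half0 : 0 < 2^-1 :> R by [].
  move/cvgr0Pnorm_le : vw => /(_ _ half0) vw.
  near=> k.
  have vk1 : `|(n k)^-1 * (2 * `|w| ^+ 3 + w ^+ 2 + `|w|)| <= e.
    by near: k; exact: vB.
  set v := (n k)^-1 in vk1 *.
  have vpos : 0 < v by rewrite invr_gt0.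
  have v1 : v <= 2^-1 by rewrite /v lef_pV2 ?posrE.
  have wv : `|w * v| <= 2^-1.
    by rewrite mulrC /v; near: k; exact: vw.
  have := ln1D_taylor2 wv.
  set x := w * v; set L := ln (1 + x); set T := L - x + _ => HT.
  have nv : n k * v = 1 by rewrite /v divff// gt_eqF.
  have LE : L = T + x - x ^+ 2 / 2 by rewrite /T; lra.
  have -> : - (w ^+ 2 / 2) - ((n k ^+ 2 - 1) * L - n k * w) =
    - ((n k ^+ 2 - 1) * T) + x + (- x ^+ 2 / 2).
    rewrite LE /x.
    have -> : (n k ^+ 2 - 1) * (T + w * v - (w * v) ^+ 2 / 2) - n k * w =
      (n k ^+ 2 - 1) * T + (n k * v - 1) * (n k * w) - w * v 
      - ((n k * v) ^+ 2 * w ^+ 2 - (w * v) ^+ 2) / 2 by lra.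
    by rewrite nv; lra.
  apply: le_trans vk1.
  rewrite [leRHS]ger0_norm; last first.
    apply: mulr_ge0; first exact: ltW.
    apply: addr_ge0 => //; apply: addr_ge0; last exact: sqr_ge0.
    by apply: mulr_ge0 => //; exact: exprn_ge0.
  apply: le_trans (ler_normD _ _) _; apply: le_trans (lerD (ler_normD _ _) (lexx _)) _.
  rewrite normrN normrM.
  have h1 : `|n k ^+ 2 - 1| * `|T| <= v * (2 * `|w| ^+ 3).
    have -> : v * (2 * `|w| ^+ 3) = n k ^+ 2 * (2 * `|x| ^+ 3).
      rewrite /x normrM (gtr0_norm vpos).
      have -> : n k ^+ 2 * (2 * (`|w| * v) ^+ 3) = (n k * v) ^+ 2 * (v * (2 * `|w| ^+ 3)) by lra.
      by rewrite nv expr1n mul1r.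
    apply: ler_pM => //; rewrite ger0_norm; have := n2 k; nra.
  have h2 : `|x| = v * `|w| by rewrite /x normrM (gtr0_norm vpos) mulrC.
  have h3 : `|- x ^+ 2 / 2| <= v * w ^+ 2.
    rewrite mulNr normrN ger0_norm ?divr_ge0 ?sqr_ge0// /x exprMn.
    have := sqr_ge0 w; have : v ^+ 2 <= v by nra.
    nra.
  rewrite h2; lra.
have -> : normal_fun 0 1 w = expR (- (w ^+ 2 / 2)).
  by rewrite /normal_fun subr0 expr1n mulNr.
have cE : expR ((n k ^+ 2 - 1) * ln (1 + w / n k) - n k * w) @[k --> \oo]
    --> expR (- (w ^+ 2 / 2)).
  by apply: continuous_cvg => //; exact: continuous_expR.
(* Since n tends to infinity, w eventually exceeds -n and the indicator is 1. *)
apply: cvg_trans cE; apply: near_eq_cvg; near=> k.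
rewrite /chi2_kernel indicE mem_set ?mul1r//=.
rewrite in_itv/= andbT ltrNl.
by near: k; exact: cvgry_gt.
Unshelve. all: end_near. Qed.

(** The varying domains become indicator factors, so that dominated convergence runs over the whole
    line. *)
Lemma cvg_integral_chi2_kernel (R : realType) (n : R^nat) (A : nat -> set R) (B : set R) :
  (forall k, 2 <= n k) -> n @ \oo --> +oo ->
  (forall k, measurable (A k)) -> measurable B ->
  {ae (@lebesgue_measure R), forall x,
    (\1_(A k) x : R) @[k --> \oo] --> (\1_B x : R)} ->
  (\int[lebesgue_measure]_(x in A k) (chi2_kernel (n k) x)%:E)%E @[k --> \oo] -->
  (\int[lebesgue_measure]_(x in B) (normal_fun 0 1 x)%:E)%E.
Proof.
move=> n2 ny mA mB AB.
have mkE (D : set R) (f : R -> R) : (\int[lebesgue_measure]_(x in D) (f x)%:E =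
    \int[lebesgue_measure]_x (f x * \1_D x)%:E)%E.
  by rewrite integral_mkcond; apply: eq_integral => x _; rewrite patchE indicE;
    case: ifP; rewrite ?mulr1 ?mulr0.
rewrite mkE; under eq_fun do rewrite mkE.
have := @dominated_convergence _ _ R lebesgue_measure setT measurableT
  (fun k x => (chi2_kernel (n k) x * \1_(A k) x)%:E)
  (fun x => (normal_fun 0 1 x * \1_B x)%:E)
  (fun x => (expR (5 / 4))%:E * (expR (- (4^-1 * `|x|)))%:E)%E.
case => //.
- move=> k; apply/measurable_EFinP/measurable_funM; first exact: measurable_chi2_kernel.
  exact: measurable_indic (mA k).
- apply/measurable_EFinP/measurable_funM; first exact: measurable_normal_fun.
  exact: measurable_indic mB.
- apply: negligibleS AB; apply: subsetC => x /= ABx _; apply: cvg_EFin; first exact: nearW.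
  by apply: cvgM => //; exact: cvg_chi2_kernel.
- by apply: integrableZl => //; exact: integrable_expRN_norm.
- apply: aeW => x k _; rewrite /= lee_fin ger0_norm; last first.
    by rewrite mulr_ge0 ?chi2_kernel_ge0.
  apply: le_trans (chi2_kernel_le x (n2 k)).
  by rewrite ler_piMr ?chi2_kernel_ge0// indicE; case: (_ \in _).
Qed.

Lemma integrable_chi2_kernel (R : realType) (n : R) (A : set R) : 2 <= n ->
  measurable A ->
  (@lebesgue_measure R).-integrable A (fun w => (chi2_kernel n w)%:E).
Proof.
move=> n2 mA; apply: (integrableS measurableT) => //.
apply: (@le_integrable _ _ R lebesgue_measure setT measurableT _ (fun x =>
    ((expR (5 / 4))%:E * (expR (- (4^-1 * `|x|)))%:E)%E)).
- apply/measurable_EFinP; exact: measurable_chi2_kernel.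
- move=> x _; rewrite -EFinM /= lee_fin [leLHS]ger0_norm ?chi2_kernel_ge0//.
  by rewrite [leRHS]ger0_norm ?mulr_ge0 ?expR_ge0//; exact: chi2_kernel_le.
- by apply: integrableZl => //; exact: integrable_expRN_norm.
Qed.

Lemma integral_chi2_kernel_setI (R : realType) (n : R) (A : set R) :
  measurable A ->
  (\int[lebesgue_measure]_(w in A `&` `](- n)%R, +oo[) (chi2_kernel n w)%:E =
   \int[lebesgue_measure]_(w in A) (chi2_kernel n w)%:E)%E.
Proof.
move=> mA; rewrite integral_mkcondr; apply: eq_integral => x _.
by rewrite patchE /chi2_kernel indicE; case: ifP => [->//|_]; rewrite mul0r.
Qed.

(** * Gamma and the chi-squared CDF as kernel integrals *)

(** The factor that t = n^2 + n w brings out of the integral for Gamma(n^2): the Jacobian n times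
    the integrand at t = n^2. *)
Definition chi2_const (R : realType) (n : R) : R :=
  n * expR ((n ^+ 2 - 1) * ln (n ^+ 2) - n ^+ 2).

(** Substitution t = b n^2 + b n w. The scale [b] covers both uses: b = 1 for Gamma, b = 2 for the
    chi-squared density. *)
Lemma integral_gamma_density (R : realType) (n b : R) (D : set R) :
  0 < n -> 0 < b -> measurable D -> D `<=` [set t | 0 < t] ->
  (\int[lebesgue_measure]_(t in D) (t `^ (n ^+ 2 - 1) * expR (- t / b))%:E =
   (b `^ (n ^+ 2) * chi2_const n)%:E *
   \int[lebesgue_measure]_(w in (fun w => (b * n ^+ 2 + b * n * w)%R) @^-1` D)
     (chi2_kernel n w)%:E)%E.
Proof.
move=> n0 b0 mD D0.
rewrite [LHS](ge0_integral_affine (b * n ^+ 2) (c := b * n)); last 4 first.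
- exact: mulr_gt0.
- by [].
- apply: measurable_funM; first exact: measurable_powR.
  by apply: measurableT_comp => //; exact: measurable_funM.
- by move=> x; rewrite mulr_ge0 ?powR_ge0 ?expR_ge0.
have mP : measurable ((fun w => (b * n ^+ 2 + b * n * w)%R) @^-1` D).
  by rewrite -[X in measurable X]setTI; exact: affine_measurable.
(* The Jacobian b n contributes the last power of b. *)
have bE : b `^ (n ^+ 2) = b * b `^ (n ^+ 2 - 1).
  by rewrite mulr_powRB1 ?ltW// exprn_gt0.
set K := b `^ (n ^+ 2 - 1) * expR ((n ^+ 2 - 1) * ln (n ^+ 2) - n ^+ 2).
have -> : b `^ (n ^+ 2) * chi2_const n = b * n * K by rewrite bE /K /chi2_const; ring.
rewrite (EFinM (b * n) K) -[RHS]muleA; congr (_ * _)%E.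
rewrite -ge0_integralZl_EFin//; last 3 first.
- by move=> w _; rewrite lee_fin chi2_kernel_ge0.
- by apply/measurable_EFinP/measurable_funTS; exact: measurable_chi2_kernel.
- by rewrite mulr_ge0 ?powR_ge0 ?expR_ge0.
(* Positivity of t puts w above -n, so the indicator is 1 and the power can be written through
   [expR] and [ln]. *)
apply: eq_integral => w; rewrite inE/= => /D0/= pos.
rewrite -EFinM; congr EFin.
have e1 : b * n ^+ 2 + b * n * w = b * (n ^+ 2 * (1 + w / n)).
  by field; rewrite gt_eqF.
have w1 : 0 < 1 + w / n.
  by move: pos; rewrite e1 pmulr_rgt0// pmulr_rgt0// exprn_gt0.
have wn : - n < w.
  by move: w1; rewrite -(@ltr_pM2r _ n)// mul0r mulrDl divfK ?gt_eqF//; lra.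
rewrite /chi2_kernel indicE mem_set ?mul1r/=; last by rewrite in_itv/= andbT.
rewrite e1 powRM; [|by rewrite ltW|by rewrite mulr_ge0 ?sqr_ge0// ltW].
rewrite /K -mulrA -[RHS]mulrA; congr (_ * _).
rewrite /powR gt_eqF ?mulr_gt0 ?exprn_gt0//.
rewrite -!expRD; congr expR.
rewrite lnM ?posrE ?exprn_gt0//.
have -> : - (b * (n ^+ 2 * (1 + w / n))) / b = - n ^+ 2 - n * w.
  by field; rewrite !gt_eqF.
ring.
Qed.

Lemma GammaE (R : realType) (n : R) : 2 <= n ->
  Gamma (n ^+ 2) = chi2_const n *
    fine (\int[lebesgue_measure]_w (chi2_kernel n w)%:E)%E.
Proof.
move=> n2; have n0 : 0 < n by lra.
rewrite /Gamma.
under eq_integral => t _ do rewrite -[X in expR X]divr1.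
rewrite integral_gamma_density//; last by rewrite -set_itvoy.
rewrite powR1 mul1r.
have -> : (fun w => (1 * n ^+ 2 + 1 * n * w)%R) @^-1` [set t | 0 < t] = setT `&` `]- n, +oo[.
  rewrite setTI; apply/seteqP; split => w /=; rewrite in_itv/= andbT !mul1r expr2 -mulrDr pmulr_rgt0//; lra.
rewrite integral_chi2_kernel_setI// fineM//.
by apply: integrable_fin_num => //; exact: integrable_chi2_kernel.
Qed.

Lemma Gamma_ge0 (R : realType) (s : R) : 0 <= Gamma s.
Proof.
apply: fine_ge0; apply: integral_ge0 => x _.
by rewrite lee_fin mulr_ge0 ?powR_ge0 ?expR_ge0.
Qed.

(** The substitution with b = 2 brings out 2^(n^2) times [chi2_const n]; expanding Gamma by [GammaE]
    shows the same product in the denominator, and the two cancel. *)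
Lemma chi2_cdfE (R : realType) (n z : R) : 2 <= n ->
  chi2_cdf (2 * n ^+ 2) (2 * n ^+ 2 + 2 * n * z) =
  fine (\int[lebesgue_measure]_(w in `]-oo, z]) (chi2_kernel n w)%:E)%E /
  fine (\int[lebesgue_measure]_w (chi2_kernel n w)%:E)%E.
Proof.
move=> n2; have n0 : 0 < n by lra.
have kE : 2 * n ^+ 2 / 2 = n ^+ 2 by field.
rewrite /chi2_cdf /chi2_pdf kE.
set C := (2 `^ (n ^+ 2) * Gamma (n ^+ 2))^-1.
under eq_integral => t _ do rewrite mulrC EFinM.
rewrite ge0_integralZl_EFin//; last 3 first.
- by move=> t _; rewrite lee_fin mulr_ge0 ?powR_ge0 ?expR_ge0.
- apply/measurable_EFinP/measurable_funTS/measurable_funM; first exact: measurable_powR.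
  by apply: measurableT_comp => //; exact: measurable_funM.
- by rewrite invr_ge0 mulr_ge0 ?powR_ge0 ?Gamma_ge0.
rewrite integral_gamma_density//; last by move=> t /=; rewrite in_itv/= => /andP[].
have -> : (fun w => (2 * n ^+ 2 + 2 * n * w)%R) @^-1` `]0, 2 * n ^+ 2 + 2 * n * z] =
    `]-oo, z] `&` `]- n, +oo[.
  apply/seteqP; split => w /=; rewrite !in_itv/= andbT lerD2l ler_pM2l ?mulr_gt0//.
    move=> /andP[h ->]; split => //.
    by move: h; rewrite expr2 mulrA -mulrDr pmulr_rgt0 ?mulr_gt0//; lra.
  move=> [-> h]; rewrite andbT.
  by rewrite expr2 mulrA -mulrDr pmulr_rgt0 ?mulr_gt0//; lra.
rewrite integral_chi2_kernel_setI//.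
have fN : (\int[lebesgue_measure]_(w in `]-oo, z]) (chi2_kernel n w)%:E)%E \is a fin_num.
  by apply: integrable_fin_num => //; exact: integrable_chi2_kernel.
rewrite fineM// ?fin_numM// fineM//= /C GammaE// (mulrA (2 `^ _)) invfM.
have c0 : 0 < 2 `^ (n ^+ 2) * chi2_const n by rewrite !mulr_gt0 ?powR_gt0 ?expR_gt0.
by rewrite mulrACA mulVf ?gt_eqF// mul1r mulrC.
Qed.

(** * Gaussian integrals and the limit of the standardised CDF *)

Lemma normal_funE (R : realType) (w : R) :
  (normal_fun 0 1 w)%:E = ((normal_peak 1)^-1%:E * (normal_pdf 0 1 w)%:E)%E.
Proof.
have nz : 1 != 0 :> R by [].
by rewrite normal_pdfE// -EFinM mulKf// gt_eqF// normal_peak_gt0.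
Qed.

Lemma integrable_normal_fun (R : realType) (A : set R) : measurable A ->
  (@lebesgue_measure R).-integrable A (fun w => (normal_fun 0 1 w)%:E).
Proof.
move=> mA; under eq_fun do rewrite normal_funE.
apply: integrableZl => //.
by apply: (integrableS measurableT) => //; exact: integrable_normal_pdf.
Qed.

Lemma fine_integral_normal_fun (R : realType) (A : set R) : measurable A ->
  fine (\int[lebesgue_measure]_(w in A) (normal_fun 0 1 w)%:E)%E =
  (normal_peak 1)^-1 * fine (\int[lebesgue_measure]_(w in A) (normal_pdf 0 1 w)%:E)%E.
Proof.
move=> mA; under eq_integral do rewrite normal_funE.
rewrite ge0_integralZl_EFin//; last 3 first.
- by move=> t _; rewrite lee_fin normal_pdf_ge0.
- apply/measurable_EFinP/measurable_funTS; exact: measurable_normal_pdf.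
- by rewrite invr_ge0 normal_peak_ge0.
rewrite fineM//; apply: integrable_fin_num => //.
by apply: (integrableS measurableT) => //; exact: integrable_normal_pdf.
Qed.

(** Gives Phi the quotient form of [chi2_cdfE], so that numerator and denominator converge
    separately. *)
Lemma PhiE (R : realType) (y : R) : Phi y =
  fine (\int[lebesgue_measure]_(w in `]-oo, y]) (normal_fun 0 1 w)%:E)%E /
  fine (\int[lebesgue_measure]_w (normal_fun 0 1 w : R)%:E)%E.
Proof.
have nz : 1 != 0 :> R by [].
rewrite !fine_integral_normal_fun// integral_normal_pdf/= mulr1 mulrC invrK mulVKf//.
by rewrite gt_eqF// normal_peak_gt0.
Qed.

(** Convergence can fail only at x = l, and a single point is null. *)
Lemma ae_cvg_indic_itvNyc (R : realType) (y : R^nat) (l : R) :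
  y @ \oo --> l ->
  {ae (@lebesgue_measure R), forall x : R,
    (\1_(`]-oo, y k]) x : R) @[k --> \oo] --> (\1_(`]-oo, l]) x : R)}.
Proof.
move=> yl; exists [set l]; split => //; first by rewrite lebesgue_measure_set1.
move=> x /= ncv; apply: contrapT => xl; apply: ncv.
have [xltl|lltx] := ltP x l; apply: cvg_near_cst.
  apply: filterS (cvgr_ge _ yl _ xltl) => k xyk.
  by rewrite !indicE !mem_set//= in_itv//= ltW.
have lx : l < x by rewrite lt_neqAle lltx andbT eq_sym; exact/eqP.
apply: filterS (cvgr_lt _ yl _ lx) => k ykx.
by rewrite !indicE !memNset//= in_itv/= leNgt ?ykx ?lx.
Qed.

(** Constant [y] serves the quantile limit; a moving [y] serves the pooled CDF, whose argument is
    built from quantiles depending on [k]. *)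
Lemma cvg_chi2_cdf (R : realType) (n y : R^nat) (l : R) :
  (forall k, 2 <= n k) -> n @ \oo --> +oo -> y @ \oo --> l ->
  chi2_cdf (2 * n k ^+ 2) (2 * n k ^+ 2 + 2 * n k * y k) @[k --> \oo] --> Phi l.
Proof.
move=> n2 ny yl; rewrite PhiE.
under eq_fun do rewrite chi2_cdfE//.
have nf A : measurable A ->
    (\int[lebesgue_measure]_(w in A) (normal_fun 0 1 w : R)%:E)%E \is a fin_num.
  by move=> mA; apply: integrable_fin_num => //; exact: integrable_normal_fun.
apply: cvgM; [|apply: cvgV].
- apply: fine_cvg; rewrite fineK ?nf//.
  apply: cvg_integral_chi2_kernel => //; exact: ae_cvg_indic_itvNyc.
- rewrite fine_integral_normal_fun// integral_normal_pdf/= mulr1 invr_eq0.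
  by rewrite gt_eqF// normal_peak_gt0.
- apply: fine_cvg; rewrite fineK ?nf//.
  apply: cvg_integral_chi2_kernel => //.
  by apply: aeW => x; exact: cvg_cst.
Qed.

(** * Strict monotonicity and range of Phi *)

Lemma Phi_lt (R : realType) : {homo (@Phi R) : x y / x < y}.
Proof.
move=> x y xy.
have nz : 1 != 0 :> R by [].
have fP (A : set R) : measurable A -> normal_prob 0 1 A \is a fin_num.
  by move=> mA; rewrite fin_num_measure.
have -> : Phi y = Phi x + fine (normal_prob 0 1 `]x, y]).
  rewrite /Phi -fineD ?fP// -measureU//; last first.
    apply/seteqP; split => w //=; rewrite !in_itv/= => -[wx /andP[xw _]].
    by move: wx; rewrite leNgt xw.
  congr (fine (normal_prob _ _ _)); apply/seteqP; split => w /=; rewrite !in_itv/=.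
    by move=> wy; have [|] := leP w x; [left|right].
  by move=> [wx|/andP[]//]; rewrite (le_trans wx)// ltW.
rewrite ltrDl fine_gt0//; apply/andP; split; last by rewrite ltey_eq fP.
(* A lower bound for the density on ]x, y], where w^2 <= x^2 + y^2; it gives the interval positive
   mass. *)
pose c : R := normal_peak 1 * expR (- ((x ^+ 2 + y ^+ 2) / 2)).
have c0 : 0 < c by rewrite mulr_gt0 ?expR_gt0 ?normal_peak_gt0.
apply: (@lt_le_trans _ _ (\int[lebesgue_measure]_(w in `]x, y]) c%:E)%E).
  rewrite integral_cst//= lebesgue_measure_itv/= lte_fin xy -EFinB.
  by rewrite mule_gt0 ?lte_fin// subr_gt0.
rewrite /normal_prob; apply: ge0_le_integral => //.
- by move=> w _; rewrite lee_fin ltW.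
- apply/measurable_EFinP/measurable_funTS; exact: measurable_normal_pdf.
- move=> w /=; rewrite in_itv/= => /andP[xw wy].
  rewrite lee_fin normal_pdfE// ler_pM2l ?normal_peak_gt0// ler_expR.
  rewrite subr0 expr1n mulNr lerN2 ler_pM2r ?invr_gt0//.
  by have := sqr_ge0 x; have := sqr_ge0 y; have [w0|w0] := leP 0 w; nra.
Qed.

(** The identity is the random variable; this gives access to the limits of [cdf] at both
    infinities. *)
Lemma Phi_fine_cdf (R : realType) :
  exists X : {RV (normal_prob (0 : R) 1) >-> R}, forall r, Phi r = fine (cdf X r).
Proof.
pose f : measurableTypeR R -> R := idfun.
have mf : measurable_fun setT f by exact: measurable_id.
pose X : {mfun measurableTypeR R >-> R} :=
  HB.pack f (isMeasurableFun.Build _ _ _ _ f mf).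
by exists X.
Qed.

Lemma exists_Phi_ge (R : realType) (u : R) : u < 1 -> exists x, u <= Phi x.
Proof.
move=> u1; have [X PhiX] := Phi_fine_cdf R.
have /fine_cvg H := @cvg_cdfy1 _ _ R _ X.
have : \forall x \near +oo, u <= fine (cdf X x) by apply: (cvgr_ge 1 H u u1).
by move=> /filter_ex[x ux]; exists x; rewrite PhiX.
Qed.

Lemma exists_Phi_lt (R : realType) (u : R) : 0 < u -> exists x, Phi x < u.
Proof.
move=> u0; have [X PhiX] := Phi_fine_cdf R.
have /fine_cvg H := @cvg_cdfNy0 _ _ R _ X.
have : \forall x \near -oo, fine (cdf X x) < u by apply: (cvgr_lt 0 H u u0).
by move=> /filter_ex[x ux]; exists x; rewrite PhiX.
Qed.

(** * Convergence of standardised quantiles *)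

(** The infimum and strict increase give G (q - e) < u < G (q + e). Eventually [F k] satisfies the
    same inequalities at the two rescaled points, and monotonicity traps its quantile between
    them. *)
Lemma cvg_quantile (R : realType) (F : nat -> R -> R) (G : R -> R) (a b : R^nat) (u : R) :
  (forall k, 0 < b k) -> (forall k, {homo F k : x y / x <= y}) ->
  (forall z, F k (a k + b k * z) @[k --> \oo] --> G z) ->
  {homo G : x y / x < y} -> (exists x, u <= G x) -> (exists x, G x < u) ->
  (quantile (F k) u - a k) / b k @[k --> \oo] --> quantile G u.
Proof.
move=> b0 Fnd FG Ginc [x1 ux1] [x0 x0u].
set q := quantile G u.
(* [inf] is a genuine infimum only on a nonempty set bounded below; otherwise it is a default
   value. *)
have Slb : lbound [set x | u <= G x] x0.
  move=> x /= ux; rewrite leNgt; apply/negP => /Ginc xx0.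
  by have := lt_trans (le_lt_trans ux xx0) x0u; rewrite ltxx.
have Sinf : has_inf [set x | u <= G x] by split; [exists x1|exists x0].
apply/cvgrPdist_le => e e0.
have h1 : G (q - e) < u.
  rewrite ltNge; apply/negP => uG.
  have : q <= q - e by apply: ge_inf => //; exists x0.
  lra.
have h2 : u < G (q + e).
  have [x /= ux xq] := inf_adherent e0 Sinf.
  exact: le_lt_trans ux (Ginc _ _ xq).
near=> k.
have F1 : F k (a k + b k * (q - e)) < u by near: k; apply: cvgr_lt (FG _) _ h1.
have F2 : u < F k (a k + b k * (q + e)) by near: k; apply: cvgr_gt (FG _) _ h2.
(* For [F k], the left test point is a lower bound and the right one a member of the set. *)
have lbk : lbound [set x | u <= F k x] (a k + b k * (q - e)).
  move=> x /= ux; rewrite leNgt; apply/negP => /ltW /(Fnd k) xx.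
  by have := lt_le_trans (le_lt_trans xx F1) ux; rewrite ltxx.
have Q1 : a k + b k * (q - e) <= quantile (F k) u.
  apply: lb_le_inf => //; exists (a k + b k * (q + e)); exact: ltW.
have Q2 : quantile (F k) u <= a k + b k * (q + e).
  apply: ge_inf; first by exists (a k + b k * (q - e)).
  exact: ltW.
rewrite distrC ler_distl ler_pdivlMr// ler_pdivrMr//.
by apply/andP; split; lra.
Unshelve. all: end_near. Qed.

(** The kernel form supplies the finiteness required to compare integrals after [fine]. *)
Lemma chi2_cdf_nondecreasing (R : realType) (n : R) : 2 <= n ->
  {homo chi2_cdf (2 * n ^+ 2) : x y / x <= y}.
Proof.
move=> n2 x y xy.
have E t : t = 2 * n ^+ 2 + 2 * n * ((t - 2 * n ^+ 2) / (2 * n)) by field; lra.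
rewrite (E x) (E y) !chi2_cdfE//.
apply: ler_wpM2r.
  rewrite invr_ge0; apply: fine_ge0; apply: integral_ge0 => w _.
  by rewrite lee_fin chi2_kernel_ge0.
apply: fine_le.
- by apply: integrable_fin_num => //; exact: integrable_chi2_kernel.
- by apply: integrable_fin_num => //; exact: integrable_chi2_kernel.
apply: ge0_subset_integral => //.
- by apply/measurable_EFinP/measurable_funTS; exact: measurable_chi2_kernel.
- by move=> w _; rewrite lee_fin chi2_kernel_ge0.
- move=> w /=; rewrite !in_itv/= => /le_trans; apply.
  rewrite ler_pM2r ?invr_gt0; lra.
Qed.

Lemma cvg_quantile_chi2 (R : realType) (n : R^nat) (u : R) :
  (forall k, 2 <= n k) -> n @ \oo --> +oo -> 0 < u < 1 ->
  (quantile (chi2_cdf (2 * n k ^+ 2)) u - 2 * n k ^+ 2) / (2 * n k) @[k --> \oo]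
    --> quantile Phi u.
Proof.
move=> n2 ny /andP[u0 u1]; apply: cvg_quantile.
- by move=> k; have := n2 k; lra.
- by move=> k; exact: chi2_cdf_nondecreasing.
- by move=> z; apply: cvg_chi2_cdf => //; exact: cvg_cst.
- exact: Phi_lt.
- exact: exists_Phi_ge.
- exact: exists_Phi_lt.
Qed.

Theorem mainTheorem7 (R : realType) (M : nat) (p : 'I_M -> R) :
  (1 <= M)%N -> (forall i, 0 < p i < 1) ->
  chi_pool p kappa @[kappa --> +oo] --> Sto p.
Proof.
(* The limit at +oo is tested along arbitrary sequences, to which dominated convergence applies. *)
move=> M1 p01; apply/cvg_pinftyP => u uy.
(* The kernel estimates need n >= 2, i.e. kappa >= 8. *)
pose n k := Num.sqrt (Num.max (u k) 8 / 2).
have nE k : 2 * n k ^+ 2 = Num.max (u k) 8.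
  rewrite sqr_sqrtr; last by rewrite divr_ge0// le_max ler0n orbT.
  by field.
have n2 k : 2 <= n k.
  have n0 : 0 <= n k by exact: sqrtr_ge0.
  have : 8 <= 2 * n k ^+ 2 by rewrite nE le_max lexx orbT.
  nra.
have ny : n @ \oo --> +oo.
  apply/cvgryPge => A; near=> k.
  have : 2 * `|A| ^+ 2 <= u k by near: k; move/cvgryPge : uy; exact.
  move=> Au.
  have : 2 * `|A| ^+ 2 <= 2 * n k ^+ 2 by rewrite nE le_max Au.
  have := n2 k; have := ler_norm A; have := normr_ge0 A; nra.
(* This keeps s n >= 2, so the CDF limit also applies with s n in place of n. *)
have sM1 : 1 <= Num.sqrt M%:R :> R by rewrite -[leLHS]sqrtr1 ler_wsqrtr// ler1n.
have sM2 : Num.sqrt M%:R ^+ 2 = M%:R :> R by rewrite sqr_sqrtr.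
set s : R := Num.sqrt M%:R in sM1 sM2.
pose z i k := (quantile (chi2_cdf (2 * n k ^+ 2)) (1 - p i) - 2 * n k ^+ 2) / (2 * n k).
have zcvg i : z i k @[k --> \oo] --> quantile Phi (1 - p i).
  by apply: cvg_quantile_chi2 => //; have := p01 i; lra.
have unscale (Q a b : R) : 0 < b -> Q = a + b * ((Q - a) / b).
  by move=> b0; field; rewrite gt_eqF.
(* M kappa = 2 (s n)^2, so pooling replaces n by s n. The centres add up exactly, and 2 n = 2 (s n)
   / s leaves the factor 1 / sqrt M of [Sto]. *)
have poolE k : chi_pool p (2 * n k ^+ 2) =
    1 - chi2_cdf (2 * (s * n k) ^+ 2)
      (2 * (s * n k) ^+ 2 + 2 * (s * n k) * (s^-1 * \sum_(i < M) z i k)).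
  have kE : M%:R * (2 * n k ^+ 2) = 2 * (s * n k) ^+ 2.
    by rewrite exprMn sM2; ring.
  have sE : \sum_(i < M) quantile (chi2_cdf (2 * n k ^+ 2)) (1 - p i) =
      2 * (s * n k) ^+ 2 + 2 * (s * n k) * (s^-1 * \sum_(i < M) z i k).
    have -> : 2 * (s * n k) * (s^-1 * \sum_(i < M) z i k) =
        \sum_(i < M) 2 * n k * z i k.
      by rewrite -big_distrr/=; field; rewrite gt_eqF//; lra.
    have -> : 2 * (s * n k) ^+ 2 = \sum_(i < M) 2 * n k ^+ 2.
      by rewrite sumr_const card_ord -kE (mulr_natl _ M).
    rewrite -big_split/=.
    apply: eq_bigr => i _; apply: unscale.
    by have := n2 k; lra.
  by rewrite /chi_pool kE sE.
have c : chi_pool p (2 * n k ^+ 2) @[k --> \oo] --> Sto p.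
  under eq_fun do rewrite poolE.
  apply: cvgB; first exact: cvg_cst.
  apply: (@cvg_chi2_cdf R (fun k => s * n k)).
  - by move=> k; have := n2 k; nra.
  - by apply: ger_cvgy ny; apply: nearW => k; have := n2 k; nra.
  - apply: cvgM; first exact: cvg_cst.
    by apply: (cvg_big (op := +%R)) => *; [exact: add_continuous|exact: zcvg].
(* Eventually u k >= 8, so the truncation disappears and 2 n^2 = u. *)
apply: cvg_trans c; apply: near_eq_cvg; near=> k.
rewrite nE; congr (chi_pool p _); apply/max_idPl.
by near: k; move/cvgryPge : uy; exact.
Unshelve. all: end_near. Qed.
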